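(* Let $m$ be a positive integer. Then $$P(3m+1,2m)=\begin{cases}7,&\text{if } m=1;\\ 13,&\text{if } m=2;\\ 14,&\text{if } m=3;\\ 3m+4,&\text{if } m\ge4.\end{cases}$$
   Context: A binary sequence $s=s_0\cdots s_{N-1}$ is an $(n,d)$-robust positioning sequence if for all $0\le i<j\le N-n$ the Hamming distance between $s_i\cdots s_{i+n-1}$ and $s_j\cdots s_{j+n-1}$ is at least $d$. $P(n,d)$ denotes the maximum length $N$ of a binary $(n,d)$-robust positioning sequence. *)

(* Defs.v *)
From mathcomp Require Import all_boot.

Set Implicit Arguments.
Unset Strict Implicit.
Unset Printing Implicit Defensive.

Definition hamming_dist (u v : seq bool) : nat :=
  count (fun p => p.1 != p.2) (zip u v).

Definition window (n : nat) (s : seq bool) (i : nat) : seq bool :=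
  take n (drop i s).

(* j + n <= size s is j <= N - n without truncated subtraction; both windows
   then lie inside s and have length exactly n. *)
Definition robust_positioning (n d : nat) (s : seq bool) : Prop :=
  forall i j : nat, i < j -> j + n <= size s ->
    d <= hamming_dist (window n s i) (window n s j).

(* P n d N states that the maximum P(n,d) exists and equals N. It is a relation
   because there is no maximum when d = 0; P_unique makes it functional. *)
Definition P (n d N : nat) : Prop :=
  (exists s : seq bool, size s = N /\ robust_positioning n d s) /\
  (forall s : seq bool, robust_positioning n d s -> size s <= N).

Lemma P_unique (n d N1 N2 : nat) : P n d N1 -> P n d N2 -> N1 = N2.
Proof.
move=> [[s1 [<- r1]] max1] [[s2 [<- r2]] max2].
by apply/eqP; rewrite eqn_leq max2 // max1.
Qed.

(* Main.v *)
(** For m >= 4 the upper bound is Plotkin's: five bits disagree in at most 6 of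
    their 10 pairs, so five windows of length 3m+1 at mutual distance 2m would
    force 20m <= 6(3m+1).  A word of length 3m+4 has four windows, and four
    bits disagree in at most 4 of their 6 pairs, so the bound 12m <= 4(3m+1)
    leaves almost no slack: nearly all blocks of four consecutive bits must be
    balanced, i.e. the word is almost 4-periodic.  It is built from 0011 0011 ...
    on about two thirds of its length followed by 0101 ..., which equalizes the
    distances at shifts 1, 2 and 3.  The cases m <= 3 are a finite search. *)
Require Import Defs.
From mathcomp Require Import all_boot.
From mathcomp Require Import zify.

Lemma windowD (a b : nat) (s : seq bool) (i : nat) :
  window (a + b) s i = window a s i ++ window b s (i + a).
Proof. by rewrite /window takeD drop_drop (addnC a). Qed.

Lemma size_window (n : nat) (s : seq bool) (i : nat) :
  i + n <= size s -> size (window n s i) = n.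
Proof. by move=> le_s; rewrite /window size_takel // size_drop; lia. Qed.

Lemma window_catl (n : nat) (s t : seq bool) (i : nat) :
  i + n <= size s -> window n (s ++ t) i = window n s i.
Proof.
move=> le_s; rewrite /window drop_cat; case: ltnP => [lt_s | ge_s].
  by rewrite takel_cat // size_drop; lia.
have ->: n = 0 by lia.
by rewrite !take0.
Qed.

Lemma window_catr (n : nat) (s t : seq bool) (i : nat) :
  window n (s ++ t) (size s + i) = window n t i.
Proof. by rewrite /window addnC -drop_drop drop_size_cat. Qed.

Lemma hamming_dist_cat (u1 u2 v1 v2 : seq bool) : size u1 = size v1 ->
  hamming_dist (u1 ++ u2) (v1 ++ v2) = hamming_dist u1 v1 + hamming_dist u2 v2.
Proof. by move=> eq_sz; rewrite /hamming_dist zip_cat // count_cat. Qed.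

Lemma hamming_dist_windowD (a b : nat) (s : seq bool) (i j : nat) :
  i + a <= size s -> j + a <= size s ->
  hamming_dist (window (a + b) s i) (window (a + b) s j) =
  hamming_dist (window a s i) (window a s j) +
  hamming_dist (window b s (i + a)) (window b s (j + a)).
Proof. by move=> le_i le_j; rewrite !windowD hamming_dist_cat // !size_window. Qed.

Lemma robust_drop (n d k : nat) (s : seq bool) :
  robust_positioning n d s -> robust_positioning n d (drop k s).
Proof.
move=> rs i j lt_ij; rewrite size_drop => le_s.
have [le_k | gt_k] := leqP k (size s); last first.
  have [-> ->]: n = 0 /\ j = 0 by lia.
  by case: i lt_ij => // i; lia.
by rewrite /window !drop_drop; apply: rs; lia.
Qed.

(** The bound [j < (size s).+1 - n] amounts to [j + n <= size s], even when [n] exceeds [size s] and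
    the range is empty. *)
Definition robustb (n d : nat) (s : seq bool) : bool :=
  all (fun j => all (fun i => d <= hamming_dist (window n s i) (window n s j))
                    (iota 0 j))
      (iota 0 ((size s).+1 - n)).

Lemma robustP (n d : nat) (s : seq bool) :
  reflect (robust_positioning n d s) (robustb n d s).
Proof.
apply: (iffP allP) => [rs i j lt_ij le_s | rs j].
  have /rs/allP: j \in iota 0 ((size s).+1 - n) by rewrite mem_iota; lia.
  by apply; rewrite mem_iota.
rewrite mem_iota => j_in; apply/allP => i; rewrite mem_iota => i_in.
by apply: rs; lia.
Qed.

(** One level of the exhaustive search. Words grow at the front; pruning loses nothing because
    suffixes of robust words are robust. *)
Definition extend_robust (n d : nat) (L : seq (seq bool)) : seq (seq bool) :=
  [seq s <- map (cons false) L ++ map (cons true) L | robustb n d s].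

Lemma mem_iter_extend_robust (n d : nat) (s : seq bool) :
  robust_positioning n d s -> s \in iter (size s) (extend_robust n d) [:: [::]].
Proof.
elim: s => [|b s IHs] // rs; rewrite /= mem_filter; apply/andP; split.
  exact/robustP.
have s_in: s \in iter (size s) (extend_robust n d) [:: [::]].
  by apply: IHs; rewrite -[s]drop0; apply: (robust_drop n d 1 (b :: s)).
by rewrite mem_cat; case: b {rs}; rewrite map_f ?orbT.
Qed.

(** A longer robust word would have a robust suffix of length exactly [N.+1]. *)
Lemma size_robust_leq (n d N : nat) (s : seq bool) :
  iter N.+1 (extend_robust n d) [:: [::]] = [::] ->
  robust_positioning n d s -> size s <= N.
Proof.
move=> iter0 rs; rewrite leqNgt; apply/negP => lt_s.
have := mem_iter_extend_robust _ _ _ (robust_drop _ _ (size s - N.+1) _ rs).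
by rewrite size_drop subKn // iter0.
Qed.

(** Column by column: k ones among five bits give k(5 - k) <= 6 disagreeing pairs. *)
Lemma plotkin5 (n : nat) (a b c d e : seq bool) :
  size a = n -> size b = n -> size c = n -> size d = n -> size e = n ->
  hamming_dist a b + hamming_dist a c + hamming_dist a d + hamming_dist a e +
  hamming_dist b c + hamming_dist b d + hamming_dist b e +
  hamming_dist c d + hamming_dist c e + hamming_dist d e <= 6 * n.
Proof.
elim: n a b c d e => [|n IHn]; first by do 5 case=> [|? ?] //.
case=> [|x a] // [|y b] // [|z c] // [|t d] // [|u e] //.
move=> [sa] [sb] [sc] [sd] [se]; have := IHn _ _ _ _ _ sa sb sc sd se.
by rewrite /hamming_dist; case: x y z t u => [] [] [] [] [] /=; lia.
Qed.

Lemma size_robust_plotkin5 (n d : nat) (s : seq bool) :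
  6 * n < 10 * d -> robust_positioning n d s -> size s <= n + 3.
Proof.
move=> lt_nd rs; rewrite leqNgt; apply/negP => lt_s.
have sz i : i <= 4 -> size (window n s i) = n by move=> ?; apply: size_window; lia.
have dist i j : i < j <= 4 -> d <= hamming_dist (window n s i) (window n s j).
  by move=> ?; apply: rs; lia.
have := plotkin5 _ _ _ _ _ _ (sz 0 isT) (sz 1 isT) (sz 2 isT) (sz 3 isT) (sz 4 isT).
have := (dist 0 1 isT, dist 0 2 isT, dist 0 3 isT, dist 0 4 isT, dist 1 2 isT).
have := (dist 1 3 isT, dist 1 4 isT, dist 2 3 isT, dist 2 4 isT, dist 3 4 isT).
by move=> [[[[? ?] ?] ?] ?] [[[[? ?] ?] ?] ?]; lia.
Qed.

(** The fixed ends let blocks added outside continue the two periodic patterns, so that their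
    windows at offsets up to 3 never meet [r]. *)
Definition framed (r : seq bool) : seq bool :=
  [:: false; false; true] ++ r ++ [:: false; true; false].

(* [framed (pumped r)] is [framed r] with 00110011 prepended and 1010 appended:
   at each of the shifts 1, 2, 3 this adds exactly 8 disagreements. *)
Definition pumped (r : seq bool) : seq bool :=
  [:: true; false; false; true; true; false; false; true] ++ r ++
  [:: false; true; false; true].

Lemma robust_pumped (n d : nat) (r : seq bool) :
  size r + 3 = n -> robust_positioning n d (framed r) ->
  robust_positioning (n + 12) (d + 8) (framed (pumped r)).
Proof.
move=> sz_r rs i j lt_ij.
pose h := [:: false; false; true; true; false; false; true; true].
pose q := [:: true; false; true; false].
have sz_s: size (framed r) = n + 3 by rewrite /= size_cat /=; lia.
have Et: framed (pumped r) = h ++ framed r ++ q.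
  by rewrite /framed /pumped /= -!catA.
pose A := h ++ [:: false; false; true] ++ r.
have EtA: framed (pumped r) = A ++ [:: false; true; false] ++ q.
  by rewrite Et /A /framed -!catA.
have szA: size A = 8 + n by rewrite /A /=; lia.
have sz_t: size (framed (pumped r)) = n + 15.
  by rewrite Et size_cat size_cat sz_s /=; lia.
rewrite sz_t => le_t; have j3: j <= 3 by lia.
(* The 8-bit head lies in [h] followed by 001, the middle is a window of [framed r] at the same
   offset, and the 4-bit tail lies in 010 followed by [q]. *)
have ->: n + 12 = 8 + (n + 4) by lia.
rewrite !hamming_dist_windowD ?sz_t; try lia.
have mid k : k <= 3 -> window n (framed (pumped r)) (k + 8) = window n (framed r) k.
  by move=> ?; rewrite Et addnC (window_catr _ h) window_catl //; lia.
have tail k : window 4 (framed (pumped r)) (k + 8 + n) =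
    window 4 ([:: false; true; false] ++ q) k.
  by rewrite EtA -addnA addnC -szA window_catr.
rewrite !mid ?tail; try lia.
have := rs i j lt_ij; rewrite sz_s => /(_ ltac:(lia)).
rewrite addnCA => le_d; apply: leq_add => //.
(* Head and tail contribute 4 + 4, 8 + 0 and 4 + 4 at shifts 1, 2 and 3. *)
move: i j lt_ij j3 {le_t rs le_d}.
by case=> [|[|[|i]]] [|[|[|[|j]]]] //; rewrite /hamming_dist /window /= take0.
Qed.

(** Here [m] is one less than in the theorem. Pumping lengthens [r] by 12, which raises [m] by 4,
    hence four seeds; each framed seed is a prefix of 00110011... continued by alternating bits. *)
Lemma ex_robust_framed (m : nat) : exists r : seq bool,
  size r = 3 * m + 1 /\ robust_positioning (3 * m + 4) (2 * m + 2) (framed r).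
Proof.
have [k] := ubnP m; elim: k m => // k IHk [|[|[|[|m]]]] lt_mk.
- by exists [:: true]; split; last exact/robustP.
- by exists [:: true; false; false; true]; split; last exact/robustP.
- exists [:: true; false; false; true; true; false; true].
  by split; last exact/robustP.
- exists [:: true; false; false; true; true; false; false; true; false; true].
  by split; last exact/robustP.
have [|r [sz_r rs]] := IHk m; first by lia.
exists (pumped r); split; first by rewrite /= size_cat sz_r /=; lia.
have ->: 3 * m.+4 + 4 = 3 * m + 4 + 12 by lia.
have ->: 2 * m.+4 + 2 = 2 * m + 2 + 8 by lia.
by apply: robust_pumped => //; lia.
Qed.

Theorem theorem7p4 (m : nat) (hm : 0 < m) :
  P (3 * m + 1) (2 * m)
    (if m == 1 then 7
     else if m == 2 then 13
     else if m == 3 then 14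
     else 3 * m + 4).
Proof.
case: m hm => [|[|[|[|m]]]] //= _; split.
- by exists [:: false; false; false; true; false; false; false]; split; last exact/robustP.
(* The search finds no robust word of length 8; likewise for lengths 14 and 15 in the next two
   cases. *)
- by move=> s; apply: size_robust_leq; vm_compute.
- exists [:: false; false; false; true; false; true; true; false; false; false;
             true; false; true].
  by split; last exact/robustP.
- by move=> s; apply: size_robust_leq; vm_compute.
- exists [:: false; false; false; true; true; false; true; false; true; true;
             false; false; false; true].
  by split; last exact/robustP.
- by move=> s; apply: size_robust_leq; vm_compute.
- have [r [sz_r rs]] := ex_robust_framed m.+3.
  exists (framed r); split; first by rewrite /= size_cat sz_r /=; lia.
  have ->: 3 * m.+4 + 1 = 3 * m.+3 + 4 by lia.
  by have ->: 2 * m.+4 = 2 * m.+3 + 2 by lia.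
(* With M = [m.+4], the condition 6(3M + 1) < 20M says exactly M > 3. *)
- move=> s /size_robust_plotkin5; rewrite -addnA; apply; lia.
Qed.
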